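(* Let $X$ be a real Banach space. Let $f:X\times X^*\to\overline{\mathbb{R}}$ be convex, proper and lower semicontinuous (in the strong topology), and define $\tilde f:X^{**}\times X^*\to\overline{\mathbb{R}}$ by $$\tilde f(x^{**},x^* )=\begin{cases} f(x^{**},x^* ),& x^{**}\in X,\\ \infty,&\text{otherwise}.\end{cases}$$ Then $$\operatorname{cl\,conv}_{w\text{-}*\times s}\tilde f(x^{**},x^* )=f^{**}(x^{**},x^* )\qquad\text{for all }(x^{**},x^* )\in X^{**}\times X^*,$$ where $\operatorname{cl\,conv}_{w\text{-}*\times s}$ stands for the convex lower semicontinuous closure in the $\sigma(X^{**},X^* )\times$strong topology of $X^{**}\times X^*$. Equivalently, $$f^{**}(x^{**},x^* )=\liminf_{(y,y^* )\to(x^{**},x^* )}f(y,y^* )\qquad\text{for all }(x^{**},x^* )\in X^{**}\times X^*,$$ where the $\liminf$ is taken over all nets in $X\times X^*$ converging to $(x^{**},x^* )$ in the $\sigma(X^{**},X^* )\times$strong topology of $X^{**}\times X^*$.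
   Context: $X$ is a real Banach space with dual $X^*$ and bidual $X^{**}$; $X$ is identified with its canonical image in $X^{**}$ (and $X^*$ with its image in $X^{***}$). $\overline{\mathbb{R}}=[-\infty,\infty]$. $\langle x,x^*\rangle=x^*(x)$ and $\langle x^*,x^{**}\rangle=x^{**}(x^* )$ denote the duality products. A function $f$ is proper if $f>-\infty$ everywhere and $f$ is not identically $\infty$. Conjugates: $(X\times X^* )^*=X^*\times X^{**}$, and $f^*(x^*,x^{**})=\sup_{(y,y^* )\in X\times X^*}\langle y,x^*\rangle+\langle y^*,x^{**}\rangle-f(y,y^* )$ on $X^*\times X^{**}$. The biconjugate $f^{**}=(f^* )^*$ is defined on $(X\times X^* )^{**}=X^{**}\times X^{***}$ and is considered here at points of $X^{**}\times X^*$: $f^{**}(x^{**},x^* )=\sup_{(y^*,y^{**})\in X^*\times X^{**}}\langle y^*,x^{**}\rangle+\langle x^*,y^{**}\rangle-f^*(y^*,y^{**})$. The convex lower semicontinuous closure of a function in a given topology is the largest convex function, lower semicontinuous in that topology, that is pointwise below it. The $\sigma(X^{**},X^* )\times$strong topology is the product of the weak-* topology of $X^{**}$ and the norm topology of $X^*$. *)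

(* Defs.v *)
From HB Require Import structures.
From mathcomp Require Import all_boot all_order all_algebra.
From mathcomp Require Import all_classical all_reals all_analysis.

Set Implicit Arguments.
Unset Strict Implicit.
Unset Printing Implicit Defensive.

Import Order.TTheory GRing.Theory Num.Theory.
Import numFieldNormedType.Exports.

Local Open Scope classical_set_scope.
Local Open Scope ring_scope.

Section DualDef.
Context {R : realType} (V : normedModType R).

Definition dual_pred : {pred V -> R^o} :=
  fun f => `[< linear f /\ continuous f >].

Record dual : Type := Dual {
  dual_fun :> V -> R^o ;
  dual_funP : dual_fun \in dual_pred }.

HB.instance Definition _ := [isSub for dual_fun].
HB.instance Definition _ := [Choice of dual by <:].

Lemma dual_predP (f : V -> R^o) :
  reflect (linear f /\ continuous f) (f \in dual_pred).
Proof. exact: asboolP. Qed.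

Fact dual_submod_closed : submod_closed dual_pred.
Proof.
split; first by apply/dual_predP; split=> [a u v|x];
  [rewrite scaler0 addr0|exact: cvg_cst].
move=> a f g /dual_predP[lf cf] /dual_predP[lg cg].
apply/dual_predP; split=> [b u v|x].
  rewrite -[LHS]/(a *: f (b *: u + v) + g (b *: u + v)).
  rewrite -[RHS]/(b *: (a *: f u + g u) + (a *: f v + g v)).
  rewrite lf lg !scalerDr !scalerA (mulrC a b) -!addrA; congr (_ + _).
  by rewrite !addrA; congr (_ + _); rewrite addrC.
by apply: cvgD; [apply: cvgZr; exact: cf|exact: cg].
Qed.

HB.instance Definition _ :=
  GRing.isSubmodClosed.Build R (V -> R^o) dual_pred dual_submod_closed.
HB.instance Definition _ := [SubChoice_isSubLmodule of dual by <:].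

Fact dual_linear (f : dual) : linear f.
Proof. by have /dual_predP[] := dual_funP f. Qed.

HB.instance Definition _ (f : dual) :=
  GRing.isLinear.Build R V R^o _ f (dual_linear f).

Lemma dual_continuous (f : dual) : continuous f.
Proof. by have /dual_predP[] := dual_funP f. Qed.

Definition dual_norm (f : dual) : R :=
  sup [set `|f x| | x in [set x : V | `|x| <= 1]].

Lemma dual_norm_has_sup (f : dual) :
  has_sup [set `|f x| | x in [set x : V | `|x| <= 1]].
Proof.
split; first by exists `|f 0|, 0 => //=; rewrite normr0.
have /linear_boundedP : bounded_near f (nbhs (0 : V)).
  exact/linear_bounded_continuous/dual_continuous.
move=> /pinfty_ex_gt0[M M0 fM].
exists M => _ [x /= x1 <-].
by apply: (le_trans (fM x)); rewrite ler_piMr// ltW.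
Qed.

Lemma le_dual_norm (f : dual) (x : V) : `|f x| <= dual_norm f * `|x|.
Proof.
have [->|x0] := eqVneq x 0; first by rewrite linear0 !normr0 mulr0.
have nx0 : 0 < `|x| by rewrite normr_gt0.
rewrite -ler_pdivrMr//; apply: sup_upper_bound; first exact: dual_norm_has_sup.
exists (`|x|^-1 *: x).
  by rewrite /= normrZ normfV normr_id mulVf// normr_eq0.
by rewrite linearZ normrZ normfV normr_id mulrC.
Qed.

Lemma dual_norm_ge0 (f : dual) : 0 <= dual_norm f.
Proof.
apply: le_trans (_ : `|f 0| <= _) => //.
apply: sup_upper_bound; first exact: dual_norm_has_sup.
by exists 0 => //=; rewrite normr0.
Qed.

Lemma dual_norm_le (f : dual) (M : R) :
  (forall x, `|x| <= 1 -> `|f x| <= M) -> dual_norm f <= M.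
Proof.
move=> fM; apply: ge_sup; first by case: (dual_norm_has_sup f).
by move=> _ [x /= x1 <-]; exact: fM.
Qed.

Fact dual_normD (f g : dual) : dual_norm (f + g) <= dual_norm f + dual_norm g.
Proof.
apply: dual_norm_le => x x1; rewrite -[(f + g) x]/(f x + g x).
apply: (le_trans (ler_normD _ _)); apply: lerD.
  by apply: (le_trans (le_dual_norm f x)); rewrite ler_piMr// dual_norm_ge0.
by apply: (le_trans (le_dual_norm g x)); rewrite ler_piMr// dual_norm_ge0.
Qed.

Fact dual_normZ (a : R) (f : dual) : dual_norm (a *: f) = `|a| * dual_norm f.
Proof.
have leZ (b : R) (g : dual) : dual_norm (b *: g) <= `|b| * dual_norm g.
  apply: dual_norm_le => x x1; rewrite -[(b *: g) x]/(b *: g x) normrZ.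
  rewrite ler_wpM2l//; apply: (le_trans (le_dual_norm g x)).
  by rewrite ler_piMr// dual_norm_ge0.
apply/eqP; rewrite eq_le leZ/=.
have [->|a0] := eqVneq a 0; first by rewrite normr0 mul0r dual_norm_ge0.
rewrite -ler_pdivlMl ?normr_gt0// -normfV.
by apply: le_trans (leZ _ _); rewrite scalerA mulVf// scale1r.
Qed.

Fact dual_norm_eq0 (f : dual) : dual_norm f = 0 -> f = 0.
Proof.
move=> f0; apply/val_inj/funext => x /=.
by apply/eqP; rewrite -normr_le0 (le_trans (le_dual_norm f x))// f0 mul0r.
Qed.

HB.instance Definition _ :=
  Lmodule_isNormed.Build R dual dual_normD dual_normZ dual_norm_eq0.

Lemma dual_normE (f : dual) : `|f| = dual_norm f.
Proof. by []. Qed.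

End DualDef.

Arguments dual_fun {R V} _ _.

Section Embedding.
Context {R : realType} {V : normedModType R}.

Fact bidual_embed_subproof (x : V) :
  (fun phi : dual V => phi x : R^o) \in @dual_pred R (dual V).
Proof.
apply/dual_predP; split=> // phi.
have x1 : 0 < `|x| + 1 by rewrite ltr_wpDl.
apply/(@cvgrPdist_lt _ _ _ (nbhs phi)) => e e0.
apply/(@nbhs_normP _ (dual V)); exists (e / (`|x| + 1)).
  by rewrite /= divr_gt0.
move=> psi /=; rewrite -[_ - psi x]/((phi - psi) x) dual_normE => phipsi.
rewrite (le_lt_trans (le_dual_norm _ _))//.
rewrite (@le_lt_trans _ _ (dual_norm (phi - psi) * (`|x| + 1)))//.
  by rewrite ler_wpM2l ?dual_norm_ge0// lerDl.
by rewrite -ltr_pdivlMr.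
Qed.

Definition bidual_embed (x : V) : dual (dual V) :=
  Dual (bidual_embed_subproof x).

End Embedding.

Section WeakStar.
Context {R : realType} (V : normedModType R).

(* [weak_star] is convertible to [dual V], and has the same vector space
   structure; its topology is the pointwise one instead of the normed one. *)
Definition weak_star : Type :=
  initial_topology (fun phi : dual V => (dual_fun phi : {ptws V -> R^o})).

HB.instance Definition _ := GRing.Lmodule.copy weak_star (dual V).
HB.instance Definition _ := Topological.copy weak_star
  (initial_topology (fun phi : dual V => (dual_fun phi : {ptws V -> R^o}))).

Lemma weak_star_cvgP (F : set_system weak_star) (phi : weak_star) :
  Filter F ->
  F --> phi <->
  forall x : V, (fun psi : weak_star => (psi : dual V) x) @ F
                  --> (phi : dual V) x.
Proof.
move=> FF; pose ev (psi : dual V) : {ptws V -> R^o} := dual_fun psi.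
split=> [Fphi x|Fphi].
  have evF : ev @ F --> ev phi.
    apply: (@cvg_trans _ (ev @ nbhs phi)); last exact: initial_continuous.
    by move=> A /=; apply: Fphi.
  by have /(@pointwise_cvgP V R^o) := evF; apply.
move=> A [_ [[B oB <-] Bphi BA]].
have evF : ev @ F --> ev phi by apply/(@pointwise_cvgP V R^o).
by apply: filterS BA _; apply: evF; exact: open_nbhs_nbhs.
Qed.

Lemma weak_star_continuous_eval (x : V) :
  continuous (fun psi : weak_star => (psi : dual V) x).
Proof.
by move=> phi; have /weak_star_cvgP := @cvg_id _ (nbhs (phi : weak_star)); apply.
Qed.

Fact weak_star_add_continuous :
  continuous (fun p : weak_star * weak_star => p.1 + p.2).
Proof.
move=> [phi psi]; apply/weak_star_cvgP => x.
rewrite -[X in _ --> X]/((phi : dual V) x + (psi : dual V) x).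
have c1 : (fun p : weak_star * weak_star => (p.1 : dual V) x) @ nbhs (phi, psi)
    --> (phi : dual V) x.
  apply: (@cvg_comp _ _ _ (@fst weak_star weak_star)
    (fun psi : weak_star => (psi : dual V) x) (nbhs (phi, psi)) (nbhs phi)).
    exact: cvg_fst.
  exact: weak_star_continuous_eval.
have c2 : (fun p : weak_star * weak_star => (p.2 : dual V) x) @ nbhs (phi, psi)
    --> (psi : dual V) x.
  apply: (@cvg_comp _ _ _ (@snd weak_star weak_star)
    (fun psi : weak_star => (psi : dual V) x) (nbhs (phi, psi)) (nbhs psi)).
    exact: cvg_snd.
  exact: weak_star_continuous_eval.
exact: cvgD c1 c2.
Qed.

Fact weak_star_scale_continuous :
  continuous (fun z : R^o * weak_star => z.1 *: z.2).
Proof.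
move=> [a phi]; apply/weak_star_cvgP => x.
rewrite -[X in _ --> X]/(a * (phi : dual V) x).
have c1 : (fun z : R^o * weak_star => z.1) @ nbhs (a, phi) --> a.
  exact: cvg_fst.
have c2 : (fun z : R^o * weak_star => (z.2 : dual V) x) @ nbhs (a, phi)
    --> (phi : dual V) x.
  apply: (@cvg_comp _ _ _ (@snd R^o weak_star)
    (fun psi : weak_star => (psi : dual V) x) (nbhs (a, phi)) (nbhs phi)).
    exact: cvg_snd.
  exact: weak_star_continuous_eval.
exact: cvgM c1 c2.
Qed.

Fact weak_star_locally_convex :
  exists2 B : set_system weak_star,
    (forall b, b \in B -> convex_set b) & basis B.
Proof.
exists [set A | open A /\ convex_set A]; first by move=> b /set_mem[].
split=> [A []//|phi].
apply/weak_star_cvgP.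
  apply: filter_from_filter.
    by exists setT; split=> //; split; [exact: openT|move=> *; rewrite inE].
  move=> A B [[oA cA] Aphi] [[oB cB] Bphi]; exists (A `&` B) => //.
  split=> //; split; first exact: openI.
  move=> u v l; rewrite !inE => -[Au Bu] [Av Bv].
  by split; apply/set_mem; [apply: cA|apply: cB]; exact/mem_set.
move=> x U /= /nbhs_ballP[e /= e0 eU].
exists [set psi : weak_star | ball ((phi : dual V) x) e ((psi : dual V) x)].
  split; last exact: ballxx.
  split.
    apply: (@open_comp _ _ (fun psi : weak_star => (psi : dual V) x)).
      by move=> psi _; exact: weak_star_continuous_eval.
    exact: ball_open.
  rewrite -ball_normE.
  apply/convex_setW => u v /set_mem/= ue /set_mem/= ve l l0 l1.
  apply/mem_set => /=.
  rewrite [X in `|X|](_ : _ = l%:num * ((phi : dual V) x - (u : dual V) x) +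
      (1 - l%:num) * ((phi : dual V) x - (v : dual V) x)); last first.
    rewrite -[LHS]/((phi : dual V) x -
      (l%:num * (u : dual V) x + (1 - l%:num) * (v : dual V) x)).
    by rewrite !mulrBr addrACA -opprD -mulrDl subrKC mul1r.
  rewrite (le_lt_trans (ler_normD _ _))// !normrM.
  rewrite (gtr0_norm l0) (@gtr0_norm _ (1 - l%:num)) ?subr_gt0//.
  rewrite -[ltRHS]mul1r -[X in _ < X * _](subrKC l%:num) [ltRHS]mulrDl.
  by rewrite ltrD// ltr_pM2l// subr_gt0.
by move=> psi /= /eU.
Qed.

HB.instance Definition _ := PreTopologicalLmod_isTvs.Build R weak_star
  weak_star_add_continuous weak_star_scale_continuous weak_star_locally_convex.
(* The previous factory only provides the uniform structure. *)
HB.instance Definition _ := PreTopologicalNmodule_isTopologicalNmodule.Build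
  weak_star weak_star_add_continuous.
HB.instance Definition _ := TopologicalNmodule_isTopologicalLmodule.Build
  R weak_star weak_star_scale_continuous.
HB.instance Definition _ := Uniform_isTvs.Build
  R weak_star weak_star_locally_convex.

End WeakStar.

Section ConvexFunctions.
Context {R : realType}.
Local Open Scope ereal_scope.

Definition proper_efun {T : Type} (f : T -> \bar R) : Prop :=
  (forall x, -oo < f x) /\ exists x, f x != +oo.

Definition epigraph {T : Type} (f : T -> \bar R) : set (T * R^o) :=
  [set p | f p.1 <= p.2%:E].

(* Convexity is expressed on the epigraph because [+oo + -oo] may occur in
   [t * f x + (1 - t) * f y] (and is [-oo] for the addition of [\bar R]). *)
Definition convex_efun {E : lmodType R} (f : E -> \bar R) : Prop :=
  convex_set (epigraph f).

Definition lsc_convex_minorants {E : tvsType R}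
    (f : E -> \bar R) : set (E -> \bar R) :=
  [set g | [/\ convex_efun g, lower_semicontinuous g & forall x, g x <= f x]].

Definition cl_conv {E : tvsType R} (f : E -> \bar R) :
    E -> \bar R :=
  fun x => ereal_sup [set g x | g in lsc_convex_minorants f].

Lemma cl_conv_minorant {E : tvsType R} (f : E -> \bar R) :
  lsc_convex_minorants f (cl_conv f).
Proof.
split.
- move=> p q l; rewrite !inE => /= hp hq; rewrite /epigraph /cl_conv /=.
  apply: ge_ereal_sup => _ [g [cg lg gf] <-].
  have gp : g p.1 <= p.2%:E.
    by apply: le_trans hp; apply: ereal_sup_ubound; exists g.
  have gq : g q.1 <= q.2%:E.
    by apply: le_trans hq; apply: ereal_sup_ubound; exists g.
  by have := cg p q l; rewrite !inE; apply.
- move=> x a /ereal_sup_gt[_ [g [cg lg gf] <-]] /lg[U xU Ua].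
  exists U => // y /Ua /lt_le_trans; apply.
  by apply: ereal_sup_ubound; exists g.
- by move=> x; apply: ge_ereal_sup => _ [g [_ _ gf] <-].
Qed.

Lemma cl_conv_greatest {E : tvsType R} (f g : E -> \bar R) :
  lsc_convex_minorants f g -> forall x, g x <= cl_conv f x.
Proof. by move=> fg x; apply: ereal_sup_ubound; exists g. Qed.

End ConvexFunctions.

Section Conjugates.
Context {R : realType}.
Local Open Scope ereal_scope.

(* The dual of [V * W] is identified with [dual V * dual W]. *)
Definition fenchel_conj {V W : normedModType R} (f : V * W -> \bar R) :
    dual V * dual W -> \bar R :=
  fun p => ereal_sup [set (p.1 q.1 + p.2 q.2)%:E - f q | q in [set: V * W]].

Context {X : normedModType R}.

(* The conjugate of [fenchel_conj f], which is defined on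
   [dual (dual X) * dual (dual (dual X))], at the points of
   [dual (dual X) * dual X]. *)
Definition biconjugate (f : X * dual X -> \bar R) :
    dual (dual X) * dual X -> \bar R :=
  fun p => fenchel_conj (fenchel_conj f) (p.1, bidual_embed p.2).

Lemma biconjugateE (f : X * dual X -> \bar R) (p : dual (dual X) * dual X) :
  biconjugate f p =
  ereal_sup [set (p.1 q.1 + q.2 p.2)%:E - fenchel_conj f q
            | q in [set: dual X * dual (dual X)]].
Proof. by []. Qed.

(* [bidual_embed] is injective, so that the choice of [x] does not matter. *)
Definition extend_bidual (f : X * dual X -> \bar R) :
    weak_star (dual X) * dual X -> \bar R :=
  fun p => if pselect (exists x : X, bidual_embed x = p.1) is left px
           then f (sval (cid px), p.2) else +oo.

End Conjugates.

Section Nets.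
Context {I : Type}.

Definition directed (le : I -> I -> Prop) : Prop :=
  [/\ inhabited I, (forall i, le i i),
      (forall j i k, le i j -> le j k -> le i k) &
      (forall i j, exists k, le i k /\ le j k)].

Definition tails (le : I -> I -> Prop) : set_system I :=
  filter_from [set: I] (fun i => [set j | le i j]).

Lemma tails_proper_filter (le : I -> I -> Prop) :
  directed le -> ProperFilter (tails le).
Proof.
move=> [[i0] lexx letr lesup]; apply: filter_from_proper => [|i _].
  apply: filter_from_filter; first by exists i0.
  move=> i j _ _; have [k [ik jk]] := lesup i j.
  by exists k => // l kl; split; [exact: letr kl|exact: letr kl].
by exists i.
Qed.

End Nets.

(* The lower limit over all nets is the least of the lower limits along the
   nets that converge to [p]. For a net [u] indexed by [(I, le)],
   [u @ tails le --> p] is convergence of [u] to [p], and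
   [limf_einf f (u @ tails le)] is the supremum over [i] of the
   infima of [f (u j)] for [le i j]. *)
Definition net_liminf {R : realType} {X : normedModType R}
    (f : X * dual X -> \bar R) (p : weak_star (dual X) * dual X) : \bar R :=
  ereal_inf [set l | exists (I : Type) (le : I -> I -> Prop)
                            (u : I -> X * dual X),
    [/\ directed le,
        (fun i => (bidual_embed (u i).1, (u i).2)
                    : weak_star (dual X) * dual X) @ tails le --> p &
        l = limf_einf f (u @ tails le)]].

(* Main.v *)
(* The conjugate of a convex, proper, lsc function has a nonempty domain
   because the function has a continuous affine minorant.  Hence f** is a
   supremum of functions [(phi, y) |-> phi u + z y - c] that lie below f on
   X x X*; each is continuous for the weak-* x strong topology, so f** is a
   convex lsc minorant of the extension of f.

   Both equalities then reduce to one approximation property: if f**(p) < r,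
   every weak-* x strong neighbourhood of p contains a point of X x X* where
   f < r.  Only finitely many functionals s_i in X* enter a neighbourhood of
   p = (phi, y0), so otherwise, for K large,
     r <= K (sum_i |s_i(x) - phi(s_i)| + |y - y0|) + f(x, y)
   on X x X*: near p this is the hypothesis, and away from p the affine minorant
   bounds f from below by the same expression, as soon as its X*-component is
   one of the s_i.  The Hahn-Banach-Lagrange theorem replaces the sublinear
   penalty by a linear functional below it, which has the form
   (sum_i l_i s_i, z) with z in X**, and this yields f**(p) >= r. *)
From HB Require Import structures.
Require Import Defs.
From mathcomp Require Import all_boot all_order all_algebra.
From mathcomp Require Import all_classical all_reals all_analysis.
From mathcomp Require Import ring lra.
Import Order.TTheory GRing.Theory Num.Theory.
Import numFieldNormedType.Exports.

Set Implicit Arguments.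
Unset Strict Implicit.
Unset Printing Implicit Defensive.

Local Open Scope classical_set_scope.
Local Open Scope ring_scope.

Lemma convex_setD (R : realType) (E : lmodType R)
    (A : set (convex_lmodType E)) (x y : E) (t : R) :
  convex_set A -> A x -> A y -> 0 <= t -> t <= 1 ->
  A (t *: x + (1 - t) *: y).
Proof.
move=> cA Ax Ay t0 t1.
exact/set_mem/(cA x y (Itv01 t0 t1) (mem_set Ax) (mem_set Ay)).
Qed.

Lemma le_infD (R : realType) (A B : set R) (z : R) :
  A !=set0 -> B !=set0 -> (forall a b, A a -> B b -> z <= a + b) ->
  z <= inf A + inf B.
Proof.
move=> A0 B0 zAB; rewrite -lerBlDl; apply: lb_le_inf => // b Bb.
rewrite lerBlDl -lerBlDr; apply: lb_le_inf => // a Aa.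
by rewrite lerBlDr; exact: zAB.
Qed.

(** * Sublinear functionals and the Hahn-Banach-Lagrange theorem *)

Section HahnBanach.
Context {R : realType} {E : lmodType R}.
Implicit Types (p q : E -> R) (C : set (E * R^o)).

Definition sublinear p :=
  (forall x y, p (x + y) <= p x + p y) /\
  (forall t x, 0 <= t -> p (t *: x) = t * p x).

Lemma sublinear_le p :
  (forall x y, p (x + y) <= p x + p y) -> p 0 <= 0 ->
  (forall t x, 0 < t -> p (t *: x) <= t * p x) -> sublinear p.
Proof.
move=> pD p0 pZ; split=> // t x; rewrite le_eqVlt => /predU1P[<-|t0].
  rewrite scale0r mul0r; apply/eqP; rewrite eq_le p0/=.
  by have := pD 0 0; rewrite addr0; lra.
apply/eqP; rewrite eq_le pZ//= -ler_pdivlMl//.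
have := pZ t^-1 (t *: x); rewrite scalerA mulVf ?gt_eqF// scale1r; apply.
by rewrite invr_gt0.
Qed.

Lemma sublinear0 p : sublinear p -> p 0 = 0.
Proof. by case=> _ /(_ 0 0 (lexx _)); rewrite scale0r mul0r. Qed.

Lemma sublinearN_le p x : sublinear p -> - p (- x) <= p x.
Proof.
by move=> sp; have := sp.1 x (- x); rewrite subrr (sublinear0 sp); lra.
Qed.

(** The infimum of [p (v + l *: c.1) + l * (c.2 - b)] over [l >= 0] and [c] in [C] is the largest
    such [q]. The hypothesis on [b] keeps it above [- p (- v)], hence finite. Any linear [L <= q]
    then has [b <= L c.1 + c.2] on [C]. *)
Lemma sublinear_reduce p C (b : R) :
  sublinear p -> convex_set C -> C !=set0 ->
  (forall c, C c -> b <= p c.1 + c.2) ->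
  exists q, [/\ sublinear q, forall x, q x <= p x &
    forall c, C c -> q (- c.1) <= c.2 - b].
Proof.
move=> sp cC C0 bC.
pose S v : set R :=
  [set z | exists l c, [/\ 0 <= l, C c & z = p (v + l *: c.1) + l * (c.2 - b)]].
have Sl v : lbound (S v) (- p (- v)).
  move=> _ [l [c [l0 Cc ->]]].
  have := sp.1 (v + l *: c.1) (- v); rewrite addrAC subrr add0r sp.2//.
  have := ler_wpM2l l0 (bC _ Cc); lra.
have hS v : has_lbound (S v) by exists (- p (- v)).
have S0 v : S v !=set0.
  by have [c Cc] := C0; exists (p (v + 0 *: c.1) + 0 * (c.2 - b)), 0, c.
have infS v z : S v z -> inf (S v) <= z by move=> Svz; exact: ge_inf.
have qp x : inf (S x) <= p x.
  have [c Cc] := C0; apply: infS; exists 0, c; split=> //.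
  by rewrite scale0r addr0 mul0r addr0.
exists (fun v => inf (S v)); split=> //; first apply: sublinear_le.
- move=> x y; apply: le_infD => // _ _ [l [c [l0 Cc ->]]] [m [d [m0 Cd ->]]].
  (* When both multipliers vanish there are no weights to normalise, and the two terms are just
     [p x] and [p y]. *)
  have [lm0|lm0] := eqVneq (l + m) 0.
    have [-> ->] : l = 0 /\ m = 0 by split; lra.
    rewrite !scale0r !addr0 !mul0r !addr0.
    exact: le_trans (qp _) (sp.1 _ _).
  have lm : 0 < l + m by rewrite lt_neqAle eq_sym lm0 addr_ge0.
  (* Convexity of [C] merges the two terms into a single one with multiplier [l + m] at the weighted
     mean [e] of [c] and [d]. *)
  pose t := l / (l + m); pose e := t *: c + (1 - t) *: d.
  have Ce : C e.
    apply: (convex_setD cC) => //; first exact: divr_ge0 (ltW lm).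
    by rewrite ler_pdivrMr// mul1r lerDl.
  have lt : (l + m) * t = l by rewrite /t mulrCA divff// mulr1.
  have mt : (l + m) * (1 - t) = m by rewrite mulrBr lt mulr1 addrAC subrr add0r.
  have comb (u v : R) :
      (l + m) * (t * u + (1 - t) * v - b) = l * (u - b) + m * (v - b).
    rewrite [LHS](_ : _ =
        (l + m) * t * u + (l + m) * (1 - t) * v - (l + m) * b).
      by rewrite lt mt; ring.
    by ring.
  apply: (@le_trans _ _ (p (x + y + (l + m) *: e.1) + (l + m) * (e.2 - b))).
    by apply: infS; exists (l + m), e; split=> //; exact: ltW.
  have -> : (l + m) *: e.1 = l *: c.1 + m *: d.1.
    by rewrite -[e.1]/(t *: c.1 + (1 - t) *: d.1) scalerDr !scalerA lt mt.
  have -> : (l + m) * (e.2 - b) = l * (c.2 - b) + m * (d.2 - b).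
    exact: comb c.2 d.2.
  by rewrite addrACA [leRHS]addrACA lerD2r sp.1.
- by apply: le_trans (qp 0) _; rewrite sublinear0.
- move=> t x t0; rewrite -ler_pdivrMl//; apply: lb_le_inf => //.
  move=> _ [l [c [l0 Cc ->]]]; rewrite ler_pdivrMl//.
  apply: infS; exists (t * l), c; split=> //; first by rewrite mulr_ge0// ltW.
  by rewrite mulrDr mulrA -(sp.2 _ _ (ltW t0)) scalerDr scalerA.
- move=> c Cc; apply: infS; exists 1, c; split=> //.
  by rewrite scale1r addNr sublinear0// mul1r add0r.
Qed.

(** Zorn's lemma for the reversed pointwise order: a nonempty chain is bounded by its pointwise
    infimum, which is finite because each member is at least [- p (- x)]. *)
Lemma minimal_sublinear p : sublinear p ->
  exists q, [/\ sublinear q, forall x, q x <= p x &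
    forall r, sublinear r -> (forall x, r x <= q x) -> r = q].
Proof.
move=> sp; pose P q := sublinear q /\ forall x, q x <= p x.
pose T := {q : E -> R | P q}.
pose le (s t : T) := `[< forall x, sval t x <= sval s x >].
have [//|//|//|//|[q [sq qp]] qmin] := @Zorn T le.
- by move=> t; apply/asboolP.
- move=> r s t /asboolP rs /asboolP st; apply/asboolP => x.
  exact: le_trans (st x) (rs x).
- move=> [s Ps] [t Pt] /asboolP/= st /asboolP/= ts.
  apply/eq_exist/funext => x; apply/eqP.
  by rewrite eq_le st ts.
- move=> A Atot.
  have [[a Aa]|A0] := pselect (A !=set0); last first.
    have Pp : sublinear p /\ forall x, p x <= p x by [].
    by exists (exist P p Pp) => s As; case: A0; exists s.
  pose S x : set R := [set sval t x | t in A].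
  have S0 x : S x !=set0 by exists (sval a x), a.
  have hS x : has_lbound (S x).
    exists (- p (- x)) => _ [t At <-]; have [st tp] := svalP t.
    by apply: le_trans (sublinearN_le x st); rewrite lerN2.
  have infS t x : A t -> inf (S x) <= sval t x.
    by move=> At; apply: ge_inf => //; exists t.
  have Pinf : sublinear (fun x => inf (S x)) /\ forall x, inf (S x) <= p x.
    split; last by move=> x; apply: le_trans (infS a x Aa) _; case: (svalP a).
    apply: sublinear_le.
    + move=> x y; apply: le_infD => // _ _ [s As <-] [t At <-].
      (* Of two members of the chain, the smaller one serves at both [x] and [y]. *)
      have [/asboolP le_st|/asboolP le_ts] := Atot s t As At.
        apply: le_trans (infS t _ At) _.
        by apply: le_trans ((svalP t).1.1 _ _) _; rewrite lerD2r.
      apply: le_trans (infS s _ As) _.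
      by apply: le_trans ((svalP s).1.1 _ _) _; rewrite lerD2l.
    + by apply: le_trans (infS a 0 Aa) _; rewrite sublinear0//; case: (svalP a).
    + move=> t x t0; rewrite -ler_pdivrMl//; apply: lb_le_inf => //.
      move=> _ [s As <-]; rewrite ler_pdivrMl//.
      by apply: le_trans (infS s _ As) _; rewrite (svalP s).1.2// ltW.
  by exists (exist P _ Pinf) => s As; apply/asboolP => x; exact: infS.
- exists q; split=> // r sr rq.
  have Pr : sublinear r /\ forall x, r x <= p x.
    by split=> // x; exact: le_trans (rq x) (qp x).
  have /qmin/(congr1 sval)/= <- // : le (exist P q (conj sq qp)) (exist P r Pr).
  exact/asboolP.
Qed.

(** Reducing [q] by the single pair [(y, - q y)] with bound 0 cannot make it smaller, so
    [q (- y) <= - q y]. Oddness turns subadditivity into additivity. *)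
Lemma minimal_sublinear_linear q : sublinear q ->
  (forall r, sublinear r -> (forall x, r x <= q x) -> r = q) ->
  linear (q : E -> R^o).
Proof.
move=> sq qmin.
have qN y : q (- y) = - q y.
  apply/eqP; rewrite eq_le; apply/andP; split; last first.
    by rewrite lerNl; exact: sublinearN_le.
  have [||c|r [sr rq rC]] := @sublinear_reduce q [set (y, - q y)] 0 sq.
  - move=> u v l; rewrite !inE/= => -> ->.
    exact: (@convmm R (convex_lmodType (E * R^o)%type)).
  - by exists (y, - q y).
  - by move=> ->/=; rewrite subrr.
  - rewrite -(qmin r sr rq).
    by have := rC _ erefl; rewrite subr0 (qmin r sr rq).
have qD x y : q (x + y) = q x + q y.
  apply/eqP; rewrite eq_le sq.1/=.
  by have := sq.1 (x + y) (- y); rewrite addrK qN; lra.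
have qZ t x : q (t *: x) = t * q x.
  have [t0|t0] := leP 0 t; first exact: sq.2.
  rewrite -[t]opprK scaleNr qN sq.2 ?mulNr// oppr_ge0; exact: ltW.
by move=> t x y; rewrite qD qZ.
Qed.

(* Due to S. Simons; here [C] is the image of the epigraph of his convex
   function under his affine map. *)
Theorem hahn_banach_lagrange p C (b : R) :
  sublinear p -> convex_set C -> C !=set0 ->
  (forall c, C c -> b <= p c.1 + c.2) ->
  exists L : E -> R^o, [/\ linear L, forall x, L x <= p x &
    forall c, C c -> b <= L c.1 + c.2].
Proof.
move=> sp cC C0 bC; have [q [sq qp qC]] := sublinear_reduce sp cC C0 bC.
have [L [sL Lq Lmin]] := minimal_sublinear sq.
have linL := minimal_sublinear_linear sL Lmin.
exists L; split=> // [x|c Cc]; first exact: le_trans (Lq x) (qp x).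
have := le_trans (Lq _) (qC c Cc); have := sublinearN_le (- c.1) sL.
by rewrite opprK; lra.
Qed.

End HahnBanach.

Lemma sublinear_scale (R : realType) (E : lmodType R) (p : E -> R) (k : R) :
  0 <= k -> sublinear p -> sublinear (fun x => k * p x).
Proof.
move=> k0 [pD pZ]; split=> [x y|t x t0]; first by rewrite -mulrDr ler_wpM2l.
by rewrite pZ// mulrCA.
Qed.

Lemma sublinear_normr (R : realType) (V : normedModType R) :
  sublinear (fun x : V => `|x|).
Proof.
split=> [x y|t x t0]; first exact: ler_normD.
by rewrite normrZ ger0_norm.
Qed.

(** Passing to pairs [(x, t)] of the epigraph keeps the infinite values of [f] out of the
    real-valued theorem; properness makes the image nonempty. *)
Lemma hahn_banach_lagrange_efun (R : realType) (E F : lmodType R)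
    (f : E -> \bar R) (h : {linear E -> F}) (a : F) (p : F -> R) (b : R) :
  convex_efun f -> proper_efun f -> sublinear p ->
  (forall x t, (f x <= t%:E)%E -> b <= p (h x - a) + t) ->
  exists L : {linear F -> R^o}, (forall y, L y <= p y) /\
    forall x t, (f x <= t%:E)%E -> b <= L (h x - a) + t.
Proof.
move=> cf [fNy [x0 fx0]] sp bf.
pose C : set (F * R^o) := [set (h c.1 - a, c.2) | c in epigraph f].
have [|||L [linL Lp LC]] := @hahn_banach_lagrange _ _ p C b sp.
- move=> _ _ l /set_mem[c Ec <-] /set_mem[d Ed <-]; apply/mem_set.
  pose l' : R := l%:num.
  exists (l' *: c + (1 - l') *: d).
    by apply: (convex_setD cf) => //; rewrite /l'.
  congr pair; rewrite -[LHS]/(h (l' *: c.1 + (1 - l') *: d.1) - a).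
  rewrite -[RHS]/(l' *: (h c.1 - a) + (1 - l') *: (h d.1 - a)).
  rewrite linearD !linearZ !scalerBr addrACA -opprD -scalerDl.
  by rewrite (_ : l' + (1 - l') = 1) ?scale1r//; ring.
- exists (h x0 - a, fine (f x0)), (x0, fine (f x0)) => //.
  by rewrite /epigraph/= fineK// fin_numElt fNy ltey.
- by move=> _ [c Ec <-]; exact: bf.
pose LL : {linear F -> R^o} :=
  HB.pack L (GRing.isLinear.Build R F R^o _ L linL).
exists LL; split=> // x t fxt; apply: (LC (h x - a, t)).
by exists (x, t).
Qed.

(** * Continuous functionals and continuous affine minorants *)

Lemma bounded_dual (R : realType) (V : normedModType R)
    (g : {linear V -> R^o}) (M : R) :
  (forall x, g x <= M * `|x|) -> exists u : dual V, forall x, u x = g x.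
Proof.
move=> gM; suff cg : continuous g.
  have gP : (g : V -> R^o) \in @dual_pred R V.
    by apply/dual_predP; split=> //; exact: linearP.
  by exists (Dual gP).
apply/linear_bounded_continuous/linear_boundedP; near=> k => x.
have Mk : M <= k by near: k; apply: nbhs_pinfty_ge; exact: num_real.
have gk y : g y <= k * `|y| by apply: le_trans (gM y) _; rewrite ler_wpM2r.
by rewrite ler_norml gk andbT lerNl -linearN -[`|x|]normrN gk.
Unshelve. all: by end_near. Qed.

(** Lower semicontinuity gives [f > r0 - 1] on the ball of radius [e] around [x0]. By convexity [f]
    cannot decrease from [x0] faster than with slope [2 / e], and Hahn-Banach-Lagrange makes this
    conical bound affine. *)
Lemma affine_minorant (R : realType) (V : normedModType R) (f : V -> \bar R) :
  convex_efun f -> proper_efun f -> lower_semicontinuous f ->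
  exists (u : dual V) (c : R), forall x, ((u x + c)%:E <= f x)%E.
Proof.
move=> cf pf lf; have [fNy [x0 fx0]] := pf.
have [r0 fr0] : exists r0, f x0 = r0%:E.
  by exists (fine (f x0)); rewrite fineK// fin_numElt fNy ltey.
have [|U /nbhs_normP[e /= e0 eU] Uf] := lf x0 (r0 - 1).
  by rewrite fr0 lte_fin; lra.
have sK : sublinear (fun x : V => 2 / e * `|x|).
  by apply: sublinear_scale (sublinear_normr V); rewrite divr_ge0// ltW.
have [x t fxt|L [LK Lf]] := @hahn_banach_lagrange_efun R V V f idfun x0
    _ (r0 - 1) cf pf sK.
  rewrite /=; have [xe|xe] := ltP `|x0 - x| e.
    have := lt_le_trans (Uf x (eU x xe)) fxt; rewrite lte_fin => /ltW/le_trans.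
    by apply; rewrite lerDr mulr_ge0// divr_ge0// ltW.
  rewrite distrC in xe; set n := `|x - x0| in xe *.
  have n0 : 0 < n by exact: lt_le_trans e0 xe.
  (* This weight puts the point of the segment at distance [e / 2] from [x0], inside the ball. *)
  pose l := e / (2 * n).
  have l0 : 0 < l by rewrite divr_gt0// mulr_gt0.
  have l1 : l <= 1 by rewrite ler_pdivrMr ?mulr_gt0// mul1r; lra.
  have := convex_setD (x := (x, t : R^o)) (y := (x0, r0 : R^o)) cf fxt.
  rewrite /epigraph/= fr0 => /(_ l (lexx _) (ltW l0) l1)/=.
  have /Uf + : U (l *: x + (1 - l) *: x0).
    apply: eU => /=.
    rewrite (_ : x0 - _ = l *: (x0 - x)); last first.
      by rewrite scalerBl scale1r scalerBr addrCA opprD addrA subrr add0r opprB.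
    rewrite normrZ gtr0_norm// distrC -/n.
    rewrite (_ : l * n = e / 2); first lra.
    by rewrite /l; field; rewrite gt_eqF.
  move=> /lt_le_trans /[apply].
  rewrite lte_fin -[_ *: _ + _]/(l * t + (1 - l) * r0) => H.
  have ln : l * (2 / e * n) = 1.
    by rewrite /l; field; rewrite !gt_eqF.
  have : 0 < l * (2 / e * n + t - r0) by rewrite !mulrDr ln; lra.
  by rewrite pmulr_rgt0//; lra.
have [u uL] := bounded_dual LK.
exists (- u), (r0 - 1 + L x0) => x.
have [fx|fx] := eqVneq (f x) +oo%E; first by rewrite fx leey.
have fxE : f x = (fine (f x))%:E by rewrite fineK// fin_numElt fNy ltey.
rewrite fxE lee_fin -[(- u) x]/(- u x) uL.
have := Lf x (fine (f x)); rewrite -fxE lexx linearB => /(_ isT).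
by rewrite -[L (idfun x) - _]/(L x - L x0 : R); lra.
Qed.

(** * Basic weak-* neighbourhoods *)

Lemma weak_star_nbhs (R : realType) (V : normedModType R) (phi : weak_star V)
    (U : set (weak_star V)) : nbhs phi U ->
  exists (s : seq V) (e : R), 0 < e /\ forall psi : weak_star V,
    (forall x, x \in s -> `|(phi : dual V) x - (psi : dual V) x| < e) -> U psi.
Proof.
pose N (a : seq V * R) : set (weak_star V) :=
  [set psi | forall x, x \in a.1 ->
    `|(phi : dual V) x - (psi : dual V) x| < a.2].
have FN : Filter (filter_from [set a | 0 < a.2] N).
  apply: filter_from_filter; first by exists ([::], 1) => /=.
  move=> [s d] [t e] /= d0 e0; exists (s ++ t, Num.min d e) => /=.
    by rewrite lt_min d0.
  move=> psi Npsi; split=> x xs.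
    by have := Npsi x; rewrite mem_cat xs lt_min => /(_ isT)/andP[].
  by have := Npsi x; rewrite mem_cat xs orbT lt_min => /(_ isT)/andP[].
(* The filter generated by the sets [N] converges pointwise to [phi], so every weak-* neighbourhood
   of [phi] belongs to it. *)
have Ncvg : filter_from [set a | 0 < a.2] N --> phi.
  apply/weak_star_cvgP => x A /nbhs_ballP[e /= e0 eA].
  exists ([:: x], e) => // psi /(_ x); rewrite inE eqxx => /(_ isT) xe.
  exact: eA.
by move=> /Ncvg[[s e] /= e0 NU]; exists s, e; split.
Qed.

(** * Functionals on products *)

Lemma linear_pairE (R : realType) (U V : lmodType R)
    (L : {linear (U * V)%type -> R^o}) (x : U) (y : V) :
  L (x, y) = L (x, 0) + L (0, y).
Proof. by rewrite -linearD; congr (L (_, _)); rewrite ?addr0 ?add0r. Qed.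

Lemma linear_pairl (R : realType) (U V : lmodType R)
    (L : {linear (U * V)%type -> R^o}) : linear (fun x => L (x, 0) : R^o).
Proof.
move=> t x y; rewrite -linearP; congr (L _).
by rewrite -[RHS]/(t *: x + y, t *: 0 + 0) scaler0 addr0.
Qed.

Lemma linear_pairr (R : realType) (U V : lmodType R)
    (L : {linear (U * V)%type -> R^o}) : linear (fun y => L (0, y) : R^o).
Proof.
move=> t x y; rewrite -linearP; congr (L _).
by rewrite -[RHS]/(t *: 0 + 0, t *: x + y) scaler0 addr0.
Qed.

Lemma pair_dual (R : realType) (V W : normedModType R)
    (u : dual (V * W)%type) :
  exists (v : dual V) (w : dual W), forall x y, u (x, y) = v x + w y.
Proof.
pose LV : {linear V -> R^o} :=
  HB.pack (fun x => u (x, 0) : R^o)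
    (GRing.isLinear.Build _ _ _ _ _ (@linear_pairl _ _ _ u)).
pose LW : {linear W -> R^o} :=
  HB.pack (fun y => u (0, y) : R^o)
    (GRing.isLinear.Build _ _ _ _ _ (@linear_pairr _ _ _ u)).
have [|v vE] := @bounded_dual R V LV (dual_norm u).
  move=> x; apply: le_trans (ler_norm _) _.
  apply: le_trans (le_dual_norm u (x, 0)) _.
  rewrite ler_wpM2l ?dual_norm_ge0// prod_normE/= normr0.
  by rewrite ge_max lexx normr_ge0.
have [|w wE] := @bounded_dual R W LW (dual_norm u).
  move=> x; apply: le_trans (ler_norm _) _.
  apply: le_trans (le_dual_norm u (0, x)) _.
  rewrite ler_wpM2l ?dual_norm_ge0// prod_normE/= normr0.
  by rewrite ge_max lexx normr_ge0.
by exists v, w => x y; rewrite vE wE linear_pairE.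
Qed.

Lemma sublinear_sum_normr (R : realType) (V : normedModType R) (n : nat) :
  sublinear (fun v : 'rV[R]_n * V => \sum_i `|v.1 0 i| + `|v.2|).
Proof.
split=> [x y|t x t0] /=.
  rewrite addrACA lerD ?ler_normD// -big_split/= ler_sum// => i _.
  by rewrite mxE ler_normD.
rewrite normrZ ger0_norm// mulrDr mulr_sumr; congr (_ + _).
by apply: eq_bigr => i _; rewrite mxE normrM ger0_norm.
Qed.

(** The row part of [L] is given by its values at the unit rows; on [V] the bound reduces to
    [M * |y|], which makes that part continuous. *)
Lemma row_pair_dual (R : realType) (V : normedModType R) (n : nat)
    (L : {linear ('rV[R]_n * V)%type -> R^o}) (M : R) :
  (forall v, L v <= M * (\sum_i `|v.1 0 i| + `|v.2|)) ->
  exists (l : 'I_n -> R) (w : dual V),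
    forall a y, L (a, y) = \sum_i a 0 i * l i + w y.
Proof.
move=> LM; pose LV : {linear V -> R^o} :=
  HB.pack (fun y => L (0, y) : R^o)
    (GRing.isLinear.Build _ _ _ _ _ (@linear_pairr _ _ _ L)).
have [|w wE] := @bounded_dual R V LV M.
  move=> x; apply: le_trans (LM _) _; rewrite big1 ?add0r// => i _.
  by rewrite mxE normr0.
exists (fun i => L (delta_mx 0 i, 0)), w => a y; rewrite linear_pairE wE.
congr (_ + _).
have pairD (x z : 'rV[R]_n) : ((x + z, 0) : 'rV[R]_n * V) = (x, 0) + (z, 0).
  by rewrite -[RHS]/(x + z, 0 + 0) addr0.
have sumP (c : 'I_n -> R) (x : 'I_n -> 'rV[R]_n) :
    ((\sum_i c i *: x i, 0) : 'rV[R]_n * V) = \sum_i c i *: (x i, 0).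
  have := @big_morph _ _ (fun x : 'rV[R]_n => (x, 0) : 'rV[R]_n * V)
    0 +%R 0 +%R pairD erefl 'I_n (index_enum _) xpredT (fun i => c i *: x i).
  move=> ->; apply: eq_bigr => i _.
  by rewrite -[RHS]/(c i *: x i, c i *: 0) scaler0.
rewrite {1}(row_sum_delta a) sumP linear_sum; apply: eq_bigr => i _.
by rewrite linearZ.
Qed.

(** * Approximation of the biconjugate by values of [f] *)

Section BiconjugateApproximation.
Context {R : realType} {X : normedModType R}.
Variable f : X * dual X -> \bar R.
Hypotheses (f_convex : convex_efun f) (f_proper : proper_efun f)
  (f_lsc : lower_semicontinuous f).

(** The hypothesis says that the conjugate of [f] is at most [c] at [(u, z)]; the left side is then
    below one term of the supremum. *)
Lemma le_biconjugate (u : dual X) (z : dual (dual X)) (c : R)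
    (p : dual (dual X) * dual X) :
  (forall q t, (f q <= t%:E)%E -> u q.1 + z q.2 - t <= c) ->
  ((p.1 u + z p.2 - c)%:E <= biconjugate f p)%E.
Proof.
move=> fc; rewrite biconjugateE.
apply: (@le_trans _ _ ((p.1 u + z p.2)%:E - fenchel_conj f (u, z))%E);
  last first.
  by apply: ereal_sup_ubound; exists (u, z).
rewrite EFinB leeB// /fenchel_conj; apply: ge_ereal_sup => _ [q _ <-] /=.
have [fq|fq] := eqVneq (f q) +oo%E; first by rewrite fq addeNy leNye.
have fqE : f q = (fine (f q))%:E.
  by rewrite fineK// fin_numElt f_proper.1 ltey.
by rewrite fqE -EFinB lee_fin; apply: fc; rewrite -fqE.
Qed.

Lemma biconjugate_approx (p : weak_star (dual X) * dual X)
    (U : set (weak_star (dual X) * dual X)) (r : R) :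
  nbhs p U -> (biconjugate f p < r%:E)%E ->
  exists q : X * dual X, U (bidual_embed q.1, q.2) /\ (f q < r%:E)%E.
Proof.
case: p => phi xs [[A B] [/= /weak_star_nbhs[s0 [d [d0 dA]]]]].
move=> /nbhs_normP[e /= e0 eB] ABU fr.
have [//|nq] := pselect (exists q : X * dual X,
  U (bidual_embed q.1, q.2) /\ (f q < r%:E)%E); exfalso.
have [u [c uc]] := affine_minorant f_convex f_proper f_lsc.
have [v [w uvw]] := pair_dual u.
(* Besides the functionals of the neighbourhood, [s] holds the component [v] of the affine minorant,
   so that the penalty [N] also controls that minorant. *)
pose s := in_tuple (v :: s0); set n := size (v :: s0) in s.
pose hf := fun q : X * dual X =>
  (\row_i (tnth s i q.1 : R), q.2) : 'rV[R]_n * dual X.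
have hlin : linear hf.
  move=> t x y; congr pair => //=; apply/rowP => i; rewrite !mxE.
  by rewrite linearP.
pose h : {linear (X * dual X)%type -> ('rV[R]_n * dual X)%type} :=
  HB.pack hf (GRing.isLinear.Build _ _ _ _ hf hlin).
pose a : 'rV[R]_n * dual X :=
  (\row_i ((phi : dual (dual X)) (tnth s i) : R), xs).
pose N (b : 'rV[R]_n * dual X) : R := \sum_i `|b.1 0 i| + `|b.2|.
have N_row (b : 'rV[R]_n * dual X) i : `|b.1 0 i| <= N b.
  by rewrite /N (bigD1 i)//= -addrA lerDl addr_ge0 ?sumr_ge0.
have N_snd (b : 'rV[R]_n * dual X) : `|b.2| <= N b by rewrite lerDr sumr_ge0.
have N0 (b : 'rV[R]_n * dual X) : 0 <= N b.
  exact: le_trans (normr_ge0 _) (N_snd b).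
(* [f q >= c' - M * N (h q - a)] for every [q], because [v] heads [s]. *)
pose M := 1 + dual_norm w.
have M0 : 0 <= M by rewrite addr_ge0 ?dual_norm_ge0.
pose c' := c + (phi : dual (dual X)) v + w xs.
(* [N (h q - a) < m] forces [q] into both factors of the neighbourhood. Where [N] is at least [m],
   the excess [K - M] makes up for the gap [r - c']. *)
pose m := Num.min d e.
have m0 : 0 < m by rewrite lt_min d0.
pose K := M + `|r - c'| / m.
have MK : M <= K by rewrite lerDl divr_ge0// ltW.
have sK : sublinear (fun b => K * N b).
  exact: sublinear_scale (le_trans M0 MK) (sublinear_sum_normr _ n).
have [q t fqt|L [LK Lf]] :=
    @hahn_banach_lagrange_efun R _ _ f h a _ r f_convex f_proper sK.
  have hE i : (h q - a).1 0 i = tnth s i q.1 - (phi : dual (dual X)) (tnth s i).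
    by rewrite !mxE.
  have [Nm|mN] := ltP (N (h q - a)) m.
    have rf : (r%:E <= f q)%E.
      rewrite leNgt; apply/negP => fqr; apply: nq; exists q; split=> //.
      apply: ABU; split=> /=.
        apply: dA => x xs0.
        have /tnthP[i xi] : x \in s by rewrite inE xs0 orbT.
        apply: le_lt_trans (_ : N (h q - a) < _).
          by rewrite distrC xi -[X in `|X|]hE; exact: N_row.
        by apply: lt_le_trans Nm _; rewrite ge_min lexx.
      apply: eB => /=; rewrite distrC; apply: le_lt_trans (N_snd (h q - a)) _.
      by apply: lt_le_trans Nm _; rewrite ge_min lexx orbT.
    apply: (@le_trans _ _ t); first by rewrite -lee_fin (le_trans rf).
    by rewrite lerDr mulr_ge0// (le_trans M0 MK).
  have t_ge : c' - M * N (h q - a) <= t.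
    have := le_trans (uc q) fqt; rewrite lee_fin.
    have -> : u q = v q.1 + w q.2 by rewrite -uvw -surjective_pairing.
    have := N_row (h q - a) ord0; rewrite hE (tnth_nth 0)/= => vN.
    have wN : `|w (q.2 - xs)| <= dual_norm w * N (h q - a).
      apply: le_trans (le_dual_norm w _) _.
      by rewrite ler_wpM2l ?dual_norm_ge0//; exact: N_snd (h q - a).
    move: vN wN; rewrite linearB !ler_norml => /andP[vN _] /andP[wN _] uct.
    rewrite /M /c'; move: wN; rewrite -[w q.2 - w xs]/(w q.2 - w xs : R); lra.
  have : r - c' <= (K - M) * N (h q - a).
    rewrite /K addrAC subrr add0r -mulrA.
    apply: le_trans (ler_norm _) _; rewrite ler_peMr//.
    by rewrite mulrC ler_pdivlMr// mul1r.
  by rewrite mulrBl; lra.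
have [l [z Lz]] := row_pair_dual LK.
(* Now [L (h q - a)] is [y q.1 - phi y + z (q.2 - xs)]. The dual point [(- y, - z)] therefore yields
   an affine minorant of [f] whose extension takes the value [r] at [(phi, xs)]. *)
pose y : dual X := \sum_i l i *: tnth s i.
have yE (g : dual (dual X)) : g y = \sum_i l i * (g (tnth s i) : R) :> R.
  by rewrite linear_sum; apply: eq_bigr => i _; rewrite linearZ.
have fin : ((phi (- y) + (- z) xs - (phi (- y) + (- z) xs - r))%:E
    <= biconjugate f (phi, xs))%E.
  apply: le_biconjugate => q t fqt.
  have := Lf q t fqt.
  rewrite -[h q - a]/(_, q.2 - xs) Lz linearB.
  have -> : \sum_i (\row_i0 (tnth s i0 q.1 : R) -
      \row_i0 ((phi : dual (dual X)) (tnth s i0) : R)) 0 i * l i =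
      (y q.1 - (phi : dual (dual X)) y : R).
    rewrite -[y q.1]/(bidual_embed q.1 y) !yE -sumrB.
    by apply: eq_bigr => i _; rewrite !mxE mulrBl ![_ * l i]mulrC.
  rewrite -[(- y) q.1]/(- y q.1) -[(- z) q.2]/(- z q.2) -[(- z) xs]/(- z xs).
  rewrite linearN.
  rewrite -[z q.2 - z xs]/(z q.2 - z xs : R).
  rewrite -[- (phi : dual (dual X)) y]/(- (phi : dual (dual X)) y : R); lra.
move: fr; rewrite ltNge; apply/negP/negPn; apply: le_trans fin.
by rewrite lee_fin; lra.
Qed.

End BiconjugateApproximation.

(** * Injectivity of the canonical embedding *)

(** Hahn-Banach-Lagrange with the norm and the one pair [(x - y, 0)] provides a functional of norm
    at most 1 that is at least [|x - y|] at [x - y]. *)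
Lemma bidual_embed_inj (R : realType) (V : normedModType R) :
  injective (@bidual_embed R V).
Proof.
move=> x y xy; apply/eqP; rewrite -subr_eq0 -normr_le0.
have [|||L [linL Ln Lxy]] := @hahn_banach_lagrange R V (fun v => `|v|)
    [set (x - y, 0)] `|x - y| (sublinear_normr V).
- move=> u v l; rewrite !inE/= => -> ->.
  exact: (@convmm R (convex_lmodType (V * R^o)%type)).
- by exists (x - y, 0).
- by move=> _ -> /=; rewrite addr0.
pose LL : {linear V -> R^o} :=
  HB.pack L (GRing.isLinear.Build _ _ _ _ L linL).
have [|u uL] := @bounded_dual R V LL 1; first by move=> v; rewrite mul1r Ln.
have := Lxy _ erefl; rewrite /= addr0 -[L _]uL linearB.
have uxy : u x = u y := congr1 (fun g : dual (dual V) => g u) xy.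
by rewrite /= uxy subrr.
Qed.

(** * Comparing extended reals through real levels *)

Section Ereal.
Context {R : realType}.
Local Open Scope ereal_scope.

Lemma lte_EFin_between (x y : \bar R) :
  x < y -> exists r : R, x < r%:E /\ r%:E < y.
Proof.
move: x y => [x| |] [y| |]//= xy.
- rewrite lte_fin in xy; exists ((x + y) / 2)%R.
  by rewrite !lte_fin; split; lra.
- by exists (x + 1)%R; rewrite lte_fin ltry ltrDl.
- by exists (y - 1)%R; rewrite lte_fin ltNyr gtrDl oppr_lt0.
- by exists 0%R; rewrite ltry ltNyr.
Qed.

Lemma lee_EFinP (x y : \bar R) :
  (forall r : R, r%:E < x -> r%:E <= y) -> x <= y.
Proof.
move=> xy; rewrite leNgt; apply/negP => /lte_EFin_between[r [yr /xy]].
by rewrite leNgt yr.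
Qed.

End Ereal.

(** * The biconjugate as a convex lower semicontinuous minorant *)

Section Biconjugate.
Context {R : realType} {X : normedModType R}.
Variable f : X * dual X -> \bar R.
Local Open Scope ereal_scope.

Lemma extend_bidualE (q : X * dual X) :
  extend_bidual f (bidual_embed q.1, q.2) = f q.
Proof.
rewrite /extend_bidual; case: pselect => [px|[]]; last by exists q.1.
by case: q px => x y px /=; congr (f (_, _)); apply: bidual_embed_inj;
  exact: (svalP (cid px)).
Qed.

Hypothesis f_proper : proper_efun f.

Lemma fenchel_conj_gtNy (q : dual X * dual (dual X)) : -oo < fenchel_conj f q.
Proof.
have [fNy [x fx]] := f_proper.
have fxE : f x = (fine (f x))%:E by rewrite fineK// fin_numElt fNy ltey.
apply: (@lt_le_trans _ _ ((q.1 x.1 + q.2 x.2)%:E - f x)).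
  by rewrite fxE -EFinB ltNyr.
by apply: ereal_sup_ubound; exists x.
Qed.

(** Each real level below the biconjugate is witnessed by one affine function with a finite
    constant: properness excludes the value [-oo] of the conjugate, and [+oo] would give a term
    [-oo]. Semicontinuity, convexity and minorization are all read off from such witnesses. *)
Lemma lt_biconjugateP (p : dual (dual X) * dual X) (r : R) :
  r%:E < biconjugate f p <-> exists (q : dual X * dual (dual X)) (c : R),
    fenchel_conj f q = c%:E /\ (r < p.1 q.1 + q.2 p.2 - c)%R.
Proof.
rewrite biconjugateE; split=> [/ereal_sup_gt[_ [q _ <-]]|[q [c [qc rq]]]].
  have := fenchel_conj_gtNy q; case qE : (fenchel_conj f q) => [c||] // _ rq.
  by exists q, c; split=> //; rewrite -EFinB lte_fin in rq.
apply: (@lt_le_trans _ _ ((p.1 q.1 + q.2 p.2)%:E - fenchel_conj f q)).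
  by rewrite qc -EFinB lte_fin.
by apply: ereal_sup_ubound; exists q.
Qed.

Lemma biconjugate_le (x : X) (y : dual X) :
  biconjugate f (bidual_embed x, y) <= f (x, y).
Proof.
apply: lee_EFinP => r /lt_biconjugateP[q [c [qc /= rq]]].
have : (q.1 x + q.2 y)%:E - f (x, y) <= c%:E.
  by rewrite -qc; apply: ereal_sup_ubound; exists (x, y).
have := f_proper.1 (x, y).
case: (f (x, y)) => [t _||]//; last by rewrite leey.
rewrite -EFinB !lee_fin => H.
by move: rq H; lra.
Qed.

(** The affine witness [g] is continuous: evaluation at [q.1] is weak-* continuous and [q.2] is norm
    continuous. It witnesses the same level wherever it exceeds [r]. *)
Lemma biconjugate_lsc :
  lower_semicontinuous (biconjugate f : weak_star (dual X) * dual X -> \bar R).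
Proof.
move=> p r /lt_biconjugateP[q [c [qc rq]]].
pose g (p : weak_star (dual X) * dual X) : R :=
  ((p.1 : dual (dual X)) q.1 + q.2 p.2 - c)%R.
exists [set p | (r < g p)%R]; last first.
  by move=> p' rp'; apply/lt_biconjugateP; exists q, c.
have cg : {for p, continuous g}.
  apply: cvgB; last exact: cvg_cst.
  apply: cvgD.
    apply: (@cvg_comp _ _ _ (@fst (weak_star (dual X)) (dual X))
      (fun psi : weak_star (dual X) => (psi : dual (dual X)) q.1)
      (nbhs p) (nbhs p.1)); first exact: cvg_fst.
    exact: weak_star_continuous_eval.
  apply: (@cvg_comp _ _ _ (@snd (weak_star (dual X)) (dual X))
      q.2 (nbhs p) (nbhs p.2)); first exact: cvg_snd.
  exact: dual_continuous.
exact: (cvgr_gt (g p) cg).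
Qed.

Lemma biconjugate_convex :
  convex_efun (biconjugate f : weak_star (dual X) * dual X -> \bar R).
Proof.
move=> [p s] [p' s'] l /set_mem/= ps /set_mem/= ps'; apply/mem_set.
rewrite /epigraph/=; apply: lee_EFinP => r /lt_biconjugateP[q [c [qc rq]]].
(* The affine witness lies below the biconjugate everywhere, so its values at the two endpoints are
   bounded by [s] and [s']. *)
have aux (p0 : weak_star (dual X) * dual X) (t : R) :
    biconjugate f p0 <= t%:E ->
    ((p0.1 : dual (dual X)) q.1 + q.2 p0.2 - c <= t)%R.
  move=> p0t; rewrite leNgt; apply/negP => tp0.
  move: p0t; rewrite leNgt => /negP; apply.
  by apply/lt_biconjugateP; exists q, c.
have := aux _ _ ps; have := aux _ _ ps'.
set k : R := l%:num => H1 H2.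
have k0 : (0 <= k)%R by rewrite /k.
have k1 : (0 <= 1 - k)%R by rewrite subr_ge0 /k.
rewrite lee_fin -[X in (_ <= X)%R]/(k * s + (1 - k) * s')%R.
have {}rq : (r < k * ((p.1 : dual (dual X)) q.1 : R) +
    (1 - k) * ((p'.1 : dual (dual X)) q.1 : R) +
    q.2 (k *: p.2 + (1 - k) *: p'.2) - c)%R by exact: rq.
have q2E : q.2 (k *: p.2 + (1 - k) *: p'.2)%R =
    (k * (q.2 p.2 : R) + (1 - k) * (q.2 p'.2 : R))%R :> R.
  by rewrite linearD !linearZ.
rewrite q2E in rq; move: (ler_wpM2l k0 H2) (ler_wpM2l k1 H1) => /=; lra.
Qed.

End Biconjugate.

(** * The closure and net formulas *)

Theorem lemma4p1 (R : realType) (X : completeNormedModType R)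
    (f : X * dual X -> \bar R)
    (f_convex : convex_efun f) (f_proper : proper_efun f)
    (f_lsc : lower_semicontinuous f) :
  (forall p : weak_star (dual X) * dual X,
      cl_conv (extend_bidual f) p = biconjugate f p) /\
  (forall p : weak_star (dual X) * dual X,
      biconjugate f p = net_liminf f p).
Proof.
split=> p; apply/eqP; rewrite eq_le; apply/andP; split.
- apply: ge_ereal_sup => _ [g [_ g_lsc gf] <-].
  (* A minorant exceeding the biconjugate at [p] would stay above some [r] on a neighbourhood [U],
     where the approximation finds a value of [f] below [r]. *)
  rewrite leNgt; apply/negP => /lte_EFin_between[r [fr /g_lsc[U pU Ur]]].
  have [q [Uq qr]] := biconjugate_approx f_convex f_proper f_lsc pU fr.
  have := lt_trans qr (Ur _ Uq).
  by rewrite ltNge -extend_bidualE gf.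
- apply: cl_conv_greatest; split.
  + exact: biconjugate_convex.
  + exact: biconjugate_lsc.
  + move=> [phi y]; rewrite /extend_bidual; case: pselect => [px|_].
      have := biconjugate_le f_proper (sval (cid px)) y.
      by rewrite (svalP (cid px)).
    exact: leey.
- apply: le_ereal_inf_tmp => _ [I [le [u [dle up ->]]]].
  (* The net is eventually in [U], where the biconjugate exceeds [r], and [f] dominates the
     biconjugate on the image of the embedding. *)
  apply: lee_EFinP => r /(biconjugate_lsc f_proper)[U pU Ur].
  rewrite limf_einfE; apply: le_trans (ereal_sup_ubound _); last first.
    exists [set q | U (bidual_embed q.1, q.2)] => //; exact: up.
  apply: le_ereal_inf_tmp => _ [q /= Uq <-].
  apply: le_trans (ltW (Ur _ Uq)) _; case: q {Uq} => x y.
  exact: biconjugate_le.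
- rewrite leNgt; apply/negP => /lte_EFin_between[r [fr]].
  apply/negP; rewrite -leNgt.
  (* The net is indexed by the neighbourhoods of [p] under reverse inclusion; it picks in each one a
     point where [f < r]. *)
  pose I := {A : set (weak_star (dual X) * dual X) | nbhs p A}.
  have [|u uP] := @choice I (X * dual X)%type (fun i q =>
      sval i (bidual_embed q.1, q.2) /\ (f q < r%:E)%E).
    move=> [A pA].
    have [q Aq] := biconjugate_approx f_convex f_proper f_lsc pA fr.
    by exists q.
  pose le (i j : I) := sval j `<=` sval i.
  apply: ge_ereal_inf; exists (limf_einf f (u @ tails le)).
    exists I, le, u; split=> //.
      split.
      + by constructor; exists setT; exact: filterT.
      + by move=> i.
      + by move=> j i k ij jk; exact: subset_trans jk ij.
      + move=> [A pA] [B pB]; exists (exist _ (A `&` B) (filterI pA pB)).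
        by split=> x [].
    move=> U pU; exists (exist _ U pU) => // j jU.
    by apply: jU; case: (uP j).
  (* Each tail contains its first point [u i], so its infimum is at most [r]. *)
  rewrite limf_einfE; apply: ge_ereal_sup => _ [V [i _ iV] <-].
  apply: ge_ereal_inf; exists (f (u i)); last by apply: ltW; case: (uP i).
  by exists (u i) => //; apply: iV => /=.
Qed.
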